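(* Let $f$ be a symmetric nontrivial tradeoff function and let $N\sim F$ be a canonical noise distribution (CND) for $f$. Set $\epsilon_f=\log\left((1-c_f)/c_f\right)$. Then the following hold: 1. $P(|N|>t)\leq\exp(-\epsilon_f\lfloor t\rfloor)\leq\exp(-\epsilon_f(t-1))$ for $t\geq 0$; 2. $\mathbb{E}|N|^n\leq\epsilon_f^{-n}\exp(\epsilon_f)\,n!$ for every integer $n>0$; 3. $N$ is $\left(4\exp(\epsilon_f)/\epsilon_f^2,\;2/\epsilon_f\right)$-sub-exponential.
   Context: For probability distributions $P,Q$ on a common measurable space, the tradeoff function $T(P,Q):[0,1]\to[0,1]$ is $T(P,Q)(\alpha)=\inf\{1-\mathbb{E}_Q(\phi)\mid \mathbb{E}_P(\phi)\leq 1-\alpha\}$, the infimum over measurable tests $\phi$ with values in $[0,1]$. For random variables $X,Y$, $T(X,Y)$ denotes the tradeoff function of their laws. A function $f:[0,1]\to[0,1]$ is a tradeoff function if $f=T(P,Q)$ for some $P,Q$; equivalently, $f$ is convex, continuous, non-decreasing, and $f(x)\leq x$ for all $x\in[0,1]$. It is nontrivial if $f(\alpha)<\alpha$ for some $\alpha\in(0,1)$, and symmetric if $f=T(P,Q)$ implies $f=T(Q,P)$. Inequalities between functions are pointwise. For a symmetric tradeoff function $f$, $c_f$ is the unique value with $f(1-c_f)=c_f$. Canonical noise distribution: let $f$ be a symmetric tradeoff function and $N$ a continuous real random variable with cdf $F$. Then $F$ (or $N$) is a canonical noise distribution (CND) for $f$ if (1) $T(N,N+m)\geq f$ for all $m\in[0,1]$;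 (2) $f(\alpha)=T(N,N+1)(\alpha)$ for all $\alpha\in(0,1)$; (3) $T(N,N+1)(\alpha)=F(F^{-1}(\alpha)-1)$ for all $\alpha\in(0,1)$, where $F^{-1}$ is the quantile function; (4) $F(x)=1-F(-x)$ for all $x\in\mathbb{R}$. A random variable $X$ with mean $\mu$ is $(\sigma^2,\alpha)$-sub-exponential if $\mathbb{E}\exp(\lambda(X-\mu))\leq\exp(\lambda^2\sigma^2/2)$ for all $|\lambda|<1/\alpha$. $\lfloor t\rfloor=\max\{n\in\mathbb{Z}\mid n\leq t\}$. *)

(* Defs.v *)
From HB Require Import structures.
From mathcomp Require Import all_boot all_order all_algebra.
From mathcomp Require Import all_classical all_reals all_analysis.
From mathcomp Require Import measurable_realfun.
Set Implicit Arguments.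
Unset Strict Implicit.
Unset Printing Implicit Defensive.
Import Order.TTheory GRing.Theory Num.Theory.
Import numFieldNormedType.Exports.
Local Open Scope classical_set_scope.
Local Open Scope ring_scope.

Definition is_test d (T : measurableType d) (R : realType) (phi : T -> R) : Prop :=
  measurable_fun setT phi /\ forall x, 0 <= phi x <= 1.

Definition tradeoff d (T : measurableType d) (R : realType)
    (P Q : probability T R) (a : R) : R :=
  inf [set 1 - fine 'E_Q[phi] | phi in
         [set phi : T -> R | is_test phi /\ ('E_P[phi] <= (1 - a)%:E)%E]].

Definition tradeoffRV d (Omega : measurableType d) (R : realType)
    (P : probability Omega R) (X Y : {RV P >-> R}) : R -> R :=
  tradeoff (distribution P X) (distribution P Y).

(* A function [0,1] -> [0,1] is represented by f : R -> R; all the notions below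
   depend only on its values on [0,1]. *)
Definition represents (R : realType) (f : R -> R) d (T : measurableType d)
    (P Q : probability T R) : Prop :=
  forall a, 0 <= a <= 1 -> f a = tradeoff P Q a.

Definition is_tradeoff (R : realType) (f : R -> R) : Prop :=
  exists (d : measure_display) (T : measurableType d) (P Q : probability T R),
    represents f P Q.

Definition symmetric_tradeoff (R : realType) (f : R -> R) : Prop :=
  is_tradeoff f /\
  forall (d : measure_display) (T : measurableType d) (P Q : probability T R),
    represents f P Q -> represents f Q P.

Definition nontrivial (R : realType) (f : R -> R) : Prop :=
  exists a, 0 < a < 1 /\ f a < a.

(* For a symmetric tradeoff function f there is exactly one such c. *)
Definition cfix (R : realType) (f : R -> R) : R :=
  get [set c : R | 0 <= c <= 1 /\ f (1 - c) = c].

(* Extended-real valued, because cfix f = 0 is possible (exactly when f is zero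
   on [0,1]); then (1 - 0) / 0 = +oo and epsf f = +oo. *)
Definition epsf (R : realType) (f : R -> R) : \bar R :=
  lne ((1 - cfix f)%:E / (cfix f)%:E)%E.

Definition rcdf d (Omega : measurableType d) (R : realType)
    (P : probability Omega R) (X : {RV P >-> R}) (x : R) : R := fine (cdf X x).

Definition quantile (R : realType) (F : R -> R) (a : R) : R :=
  inf [set x | a <= F x].

(* The random variable N is continuous in the sense that its cdf is. *)
Definition is_CND (R : realType) (f : R -> R) d (Omega : measurableType d)
    (P : probability Omega R) (N : {RV P >-> R}) : Prop :=
  let F := rcdf N in
  let shift (m : R) : {RV P >-> R} := (N \+ cst m) in
  [/\ symmetric_tradeoff f,
      continuous F &
  [/\ (forall m, 0 <= m <= 1 ->
         forall a, 0 <= a <= 1 -> f a <= tradeoffRV N (shift m) a),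
      (forall a, 0 < a < 1 -> f a = tradeoffRV N (shift 1) a),
      (forall a, 0 < a < 1 ->
         tradeoffRV N (shift 1) a = F (quantile F a - 1)) &
      (forall x, F x = 1 - F (- x))]].

Definition sub_exponential d (Omega : measurableType d) (R : realType)
    (P : probability Omega R) (X : {RV P >-> R}) (sigma2 alpha : R) : Prop :=
  let mu := fine 'E_P[X] in
  P.-integrable setT (EFin \o X) /\
  forall lambda : R, `|lambda| < 1 / alpha ->
    ('E_P[(fun w => expR (lambda * (X w - mu)))] <=
       (expR (lambda ^+ 2 * sigma2 / 2))%:E)%E.

(* Main.v *)
Require Import Defs.
From HB Require Import structures.
From mathcomp Require Import all_boot all_order all_algebra.
From mathcomp Require Import all_classical all_reals all_analysis.
From mathcomp Require Import ring lra measurable_realfun.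

(* Write F for the cdf of N and c = cfix f, so that f (1 - c) = c and, f being
   nontrivial, c < 1/2.  Tradeoff functions are convex and vanish at 0, hence
   f a <= r a on [0, 1 - c] with r = c / (1 - c) = exp (- epsf f).  The CND
   equation turns this into F (x - 1) <= r F x for x <= 0, and iterating from
   F 0 = 1/2 gives P (|N| > k) <= r ^ k.
   For the moments, |N|^n <= sum_k ((k+1)^n - k^n) 1_{|N| > k}, and
   sum_k ((k+1)^n - k^n) r^k is compared with a telescoping series built from
   the partial sums of the exponential.
   For the last item, the law of N is symmetric, so that N has mean 0 and
   2 E exp (l N) = E (exp a + exp (- a)) with a = |l N|; the right-hand side is
   expanded in powers of a, whose expectations are controlled by the moments. *)

Import Order.TTheory GRing.Theory Num.Theory.
Import numFieldNormedType.Exports.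
Local Open Scope classical_set_scope.
Local Open Scope ring_scope.

Set Implicit Arguments.
Unset Strict Implicit.
Unset Printing Implicit Defensive.

(** * Tests, and the tradeoff function of two laws *)

Section tradeoff_theory.
Context {d : measure_display} {T : measurableType d} {R : realType}.
Implicit Types (P Q : probability T R) (phi : T -> R).

Lemma test_integrable P phi : is_test phi -> P.-integrable setT (EFin \o phi).
Proof.
move=> [mphi phi01].
apply: (@le_integrable _ _ _ _ _ measurableT _ (cst 1%E)).
- exact/measurable_EFinP.
- by move=> x _ /=; rewrite normr1 lee_fin ger0_norm; have /andP[] := phi01 x.
- exact: finite_measure_integrable_cst.
Qed.

Lemma test_expectation_itv P phi : is_test phi ->
  exists2 r : R, 'E_P[phi]%E = r%:E & 0 <= r <= 1.
Proof.
move=> tphi; have [mphi phi01] := tphi.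
have Efin : 'E_P[phi]%E \is a fin_num.
  by rewrite unlock; exact/integrable_fin_num/test_integrable.
exists (fine 'E_P[phi]); first by rewrite fineK.
apply/andP; split.
  by apply/fine_ge0/expectation_ge0 => x; have /andP[] := phi01 x.
rewrite -lee_fin fineK// -(expectation_cst P 1).
apply: expectation_le => //.
- by move=> x; have /andP[] := phi01 x.
- by apply: aeW => x; have /andP[] := phi01 x.
Qed.

Lemma test_affine (phi : T -> R) (s u : R) : 0 <= s -> 0 <= u -> s + u <= 1 ->
  is_test phi -> is_test (fun x => s * phi x + u).
Proof.
move=> s0 u0 su [mphi phi01]; split.
  by apply: measurable_funD => //; exact: measurable_funM.
move=> x; have /andP[p0 p1] := phi01 x.
by apply/andP; split; nra.
Qed.

Lemma test_expectation_affine P phi (s u : R) : is_test phi ->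
  'E_P[(fun x => s * phi x + u)%R]%E = (s%:E * 'E_P[phi] + u%:E)%E.
Proof.
move=> /(@test_integrable P _) iphi; rewrite unlock.
under eq_integral do rewrite EFinD EFinM.
rewrite integralD//=; last 2 first.
- exact: integrableZl.
- exact: finite_measure_integrable_cst.
rewrite integralZl// integral_cst//=.
congr (_ + _)%E; rewrite -[RHS]mule1; congr (_ * _)%E.
exact: probability_setT.
Qed.

Lemma tradeoff_le P Q phi (a : R) : is_test phi ->
  ('E_P[phi] <= (1 - a)%:E)%E -> tradeoff P Q a <= 1 - fine 'E_Q[phi].
Proof.
move=> tphi Ephi; apply: ge_inf; last by exists phi.
exists 0 => _ [psi [tpsi _] <-].
by have [r -> /andP[]] := test_expectation_itv Q tpsi; rewrite /= subr_ge0.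
Qed.

Lemma le_tradeoff P Q (a z : R) : a <= 1 ->
  (forall phi, is_test phi -> ('E_P[phi] <= (1 - a)%:E)%E ->
     z <= 1 - fine 'E_Q[phi]) ->
  z <= tradeoff P Q a.
Proof.
move=> a1 h; apply: lb_le_inf => [|_ [phi [tphi Ephi] <-]]; last exact: h.
exists (1 - fine 'E_Q[cst 0]); exists (cst 0) => //; split.
  by split=> // x /=; rewrite lexx ler01.
by rewrite expectation_cst lee_fin subr_ge0.
Qed.

Lemma tradeoff_ge0 P Q (a : R) : a <= 1 -> 0 <= tradeoff P Q a.
Proof.
move=> a1; apply: le_tradeoff => // phi tphi _.
by have [r -> /andP[]] := test_expectation_itv Q tphi; rewrite /= subr_ge0.
Qed.

(* Post-composing a test with the affine map t |-> s t + u; (s, u) = (s, 1 - s)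
   and (s, 0) give convexity towards (0, 0) and (1, 1). *)
Lemma tradeoff_affine P Q (s u a : R) : 0 <= s -> 0 <= u -> s + u <= 1 ->
  a <= 1 ->
  tradeoff P Q (1 - u - s * (1 - a)) <= s * tradeoff P Q a + (1 - s - u).
Proof.
move=> s0 u0 su a1; rewrite -lerBlDr.
have bound phi : is_test phi -> ('E_P[phi] <= (1 - a)%:E)%E ->
    tradeoff P Q (1 - u - s * (1 - a)) - (1 - s - u) <=
      s * (1 - fine 'E_Q[phi]).
  move=> tphi Ephi; rewrite lerBlDr.
  have := @tradeoff_le P Q _ (1 - u - s * (1 - a)) (test_affine s0 u0 su tphi).
  rewrite !test_expectation_affine//.
  have [p Ep p01] := test_expectation_itv P tphi.
  have [q Eq q01] := test_expectation_itv Q tphi.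
  rewrite Eq -EFinM -EFinD/=; move: Ephi; rewrite Ep -EFinM -EFinD !lee_fin.
  by move=> pa /(_ ltac:(nra)); nra.
(* For [s = 0] the infimum cannot be reached by dividing by [s]; one admissible test, the zero test,
   is enough. *)
have [s_eq0|s_neq0] := eqVneq s 0.
  have := @bound (cst 0) ltac:(by split=> // x; rewrite lexx ler01).
  by rewrite s_eq0 !mul0r; apply; rewrite expectation_cst lee_fin subr_ge0.
have s_gt0 : 0 < s by rewrite lt_neqAle eq_sym s_neq0.
rewrite -ler_pdivrMl//; apply: le_tradeoff => // phi tphi Ephi.
by rewrite ler_pdivrMl//; exact: bound.
Qed.

End tradeoff_theory.

(** * Convexity bounds for tradeoff functions *)

Section tradeoff_function.
Context {R : realType} (f : R -> R) (ft : is_tradeoff f).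

Lemma tradeoff_function_ge0 (a : R) : 0 <= a <= 1 -> 0 <= f a.
Proof.
have [d [T [P [Q fPQ]]]] := ft.
by move=> a01; rewrite fPQ// tradeoff_ge0//; case/andP: a01.
Qed.

Lemma tradeoff_function_affine (s u a : R) : 0 <= s -> 0 <= u -> s + u <= 1 ->
  0 <= a <= 1 -> f (1 - u - s * (1 - a)) <= s * f a + (1 - s - u).
Proof.
have [d [T [P [Q fPQ]]]] := ft.
move=> s0 u0 su /andP[a0 a1]; rewrite !fPQ ?a0//; last first.
  by apply/andP; split; nra.
exact: tradeoff_affine.
Qed.

(** The case [s = 0] of the affine bound: the constant test [1 - a]. *)
Lemma tradeoff_function_le_id (a : R) : 0 <= a <= 1 -> f a <= a.
Proof.
move=> /andP[a0 a1].
have := @tradeoff_function_affine 0 (1 - a) 0.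
rewrite (_ : 1 - (1 - a) - 0 * (1 - 0) = a); last by ring.
by move=> /(_ ltac:(lra) ltac:(lra) ltac:(lra) ltac:(lra)); lra.
Qed.

Lemma tradeoff_function_le_scale (s a : R) : 0 <= s <= 1 -> 0 <= a <= 1 ->
  f (s * a) <= s * f a.
Proof.
move=> /andP[s0 s1] a01.
have := @tradeoff_function_affine s (1 - s) a.
rewrite (_ : 1 - (1 - s) - s * (1 - a) = s * a); last by ring.
rewrite (_ : 1 - s - (1 - s) = 0) ?addr0; last by ring.
by apply=> //; lra.
Qed.

(** [c = f (1 - c) <= 1 - c] leaves only [c = 1 / 2] to exclude. There the graph would touch the
    diagonal at [1 / 2], but the chord from [(a, f a)] to [(1, 1)] or to [(0, 0)], whichever passes
    over [1 / 2], lies strictly below the diagonal at that point. *)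
Lemma tradeoff_function_fix_lt_half (c : R) : nontrivial f ->
  0 <= c <= 1 -> f (1 - c) = c -> c < 1 / 2.
Proof.
move=> [a [/andP[a0 a1] faa]] /andP[c0 c1] fc.
have : f (1 - c) <= 1 - c by apply: tradeoff_function_le_id; lra.
rewrite fc => cle; rewrite lt_neqAle; apply/andP; split; last by lra.
apply/negP => /eqP chalf.
have fhalf : f (1 / 2) = 1 / 2.
  by rewrite -[RHS]chalf -fc; congr f; lra.
have [ha|ha] := leP a (1 / 2).
- pose s := (1 / 2) / (1 - a); have sa : s * (1 - a) = 1 / 2.
    by rewrite divfK//; lra.
  have s01 : 0 <= s <= 1.
    by rewrite divr_ge0/= ?ler_pdivrMr; lra.
  have := @tradeoff_function_affine s 0 a.
  rewrite sa (_ : 1 - 0 - 1 / 2 = 1 / 2) ?fhalf; last by lra.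
  have fa0 := @tradeoff_function_ge0 a.
  by move=> /(_ ltac:(lra) ltac:(lra) ltac:(lra) ltac:(lra)); nra.
- pose s := (1 / 2) / a; have sa : s * a = 1 / 2 by rewrite divfK//; lra.
  have s01 : 0 <= s <= 1 by rewrite divr_ge0/= ?ler_pdivrMr; lra.
  have := @tradeoff_function_le_scale s a.
  rewrite sa fhalf => /(_ ltac:(lra) ltac:(lra)); nra.
Qed.

End tradeoff_function.

(** * Distribution functions, shifts and quantiles *)

Section cumulative.
Context {d : measure_display} {Omega : measurableType d} {R : realType}.
Context {P : probability Omega R}.
Implicit Types (N : {RV P >-> R}).

Lemma rcdfE N (x : R) : cdf N x = (rcdf N x)%:E.
Proof. by rewrite fineK// fin_num_measure. Qed.

Lemma rcdf_nondecreasing N (x y : R) : x <= y -> rcdf N x <= rcdf N y.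
Proof. by move=> xy; rewrite -lee_fin -!rcdfE; exact: cdf_nondecreasing. Qed.

Lemma rcdf_itv N (x : R) : 0 <= rcdf N x <= 1.
Proof. by rewrite -!lee_fin -!rcdfE cdf_ge0 cdf_le1. Qed.

Lemma distribution_gt N (x : R) :
  distribution P N `]x, +oo[ = (1 - rcdf N x)%:E.
Proof.
have := cdf_ccdf_1 N x; rewrite rcdfE /ccdf => h.
by rewrite EFinB -h addrAC subee// add0e.
Qed.

(** The test that rejects above [x] is admissible at level [F x], and its type II error under the
    shifted law is the probability that [N + m <= x]. *)
Lemma tradeoff_shift_le N (m x : R) :
  tradeoffRV N ((N \+ cst m) : {RV P >-> R}) (rcdf N x) <= rcdf N (x - m).
Proof.
have tphi : is_test (\1_`]x, +oo[ : R -> R).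
  split=> [|y]; first exact: measurable_indic.
  by rewrite indicE; case: (_ \in _); rewrite lexx ler01.
have Etest (X : {RV P >-> R}) :
    'E_(distribution P X)[\1_`]x, +oo[]%E = (1 - rcdf X x)%:E.
  by rewrite expectation_indic//; exact: distribution_gt.
apply: (le_trans (@tradeoff_le _ _ _ _ _ _ _ tphi _)); rewrite Etest//=.
rewrite opprB addrCA subrr addr0 /rcdf /cdf /distribution /pushforward/=.
rewrite (_ : _ @^-1` _ = N @^-1` `]-oo, (x - m)])//.
by apply/seteqP; split=> w /=; rewrite !in_itv/= lerBrDr.
Qed.

Lemma le_quantile N (x a : R) : rcdf N x < a < 1 -> x <= quantile (rcdf N) a.
Proof.
move=> /andP[xa a1]; apply: lb_le_inf.
  (* The set defining the quantile must be nonempty for its [inf] to be meaningful; as [a < 1], the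
     limit 1 at infinity provides a point. *)
  have /(cvgr_gt 1)/(_ _ a1) : rcdf N y @[y --> +oo] --> (1 : R).
    exact/fine_cvg/cvg_cdfy1.
  by move=> /pinfty_ex_gt0[y _ /ltW]; exists y.
move=> y /= ay; rewrite leNgt; apply/negP => /ltW/(rcdf_nondecreasing N).
by lra.
Qed.

End cumulative.

(** * Geometric decay of the tails of a CND *)

Section canonical_noise.
Context {d : measure_display} {Omega : measurableType d} {R : realType}.
Context {P : probability Omega R} (N : {RV P >-> R}) (f : R -> R).
Hypotheses (f_nontriv : nontrivial f) (N_cnd : is_CND f N).

Local Notation F := (rcdf N).

Let f_tradeoff : is_tradeoff f.
Proof. by case: N_cnd => -[]. Qed.

Lemma CND_cdf_sym (x : R) : F x = 1 - F (- x).
Proof. by case: N_cnd => _ _ []. Qed.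

(* x need not be the quantile of F x, but it lies to the left of the quantile of any
   a > F x. *)
Lemma CND_cdf_shift_le (x a : R) : F x < a < 1 -> F (x - 1) <= f a.
Proof.
move=> /andP[xa a1]; have /andP[F0 _] := rcdf_itv N x.
have a01 : 0 < a < 1 by apply/andP; split=> //; lra.
case: N_cnd => _ _ [_ -> // -> // _].
by apply: rcdf_nondecreasing; rewrite lerB// le_quantile// xa.
Qed.

(** By symmetry [1 - F (- (1 / 2))] is [F (1 / 2)], and the unit shift takes [1 / 2] to [- (1 / 2)].
    The one-sided test gives the upper bound, the CND equation the lower one. *)
Lemma CND_fix : f (1 - F (- (1 / 2))) = F (- (1 / 2)).
Proof.
set c := F _; have Fhalf : F (1 / 2) = 1 - c by exact: CND_cdf_sym.
have /andP[c0 c1] : 0 <= c <= 1 := rcdf_itv N _.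
have c01 : 0 <= 1 - c <= 1 by apply/andP; split; lra.
have cshift : F (1 / 2 - 1) = c by rewrite /c; congr F; lra.
apply/le_anti/andP; split.
  case: N_cnd => _ _ [/(_ 1 ltac:(lra) _ c01) h _ _ _]; apply: (le_trans h).
  by rewrite -Fhalf (le_trans (tradeoff_shift_le N 1 _))// cshift.
(* If [c = 0] there is no level in []1 - c, 1[], but nonnegativity of [f] suffices. *)
have [->|cneq0] := eqVneq c 0; first by rewrite tradeoff_function_ge0//; lra.
have cgt0 : 0 < c by rewrite lt_neqAle eq_sym cneq0.
(* CND_cdf_shift_le only applies to levels above 1 - c = F (1/2): approach 1 - c
   from above along the segment towards 1, where f is bounded by convexity. *)
apply/ler_addgt0Pr => e e0.
pose s : R := 1 - Num.min (1 / 2) e.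
have [s0 s1 se] : [/\ 0 < s, s < 1 & 1 - s <= e].
  rewrite /s; split.
  - by have : Num.min (1 / 2) e <= 1 / 2; [rewrite ge_min lexx|lra].
  - by rewrite gtrBl lt_min e0 divr_gt0.
  - by rewrite subKr ge_min lexx orbT.
apply: (@le_trans _ _ (s * f (1 - c) + (1 - s))); last first.
  have fc0 := tradeoff_function_ge0 f_tradeoff c01.
  have := mulr_ge0 (ltac:(lra) : 0 <= 1 - s) fc0.
  by clearbody s; lra.
have := tradeoff_function_affine f_tradeoff (a := 1 - c) (s := s) (u := 0).
move=> /(_ (ltW s0) (lexx _) ltac:(lra) c01); rewrite !subr0; apply: le_trans.
rewrite -[leLHS]cshift; apply: CND_cdf_shift_le; rewrite Fhalf.
have sc0 := mulr_gt0 s0 cgt0.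
have sc1 := mulr_gt0 (ltac:(lra) : 0 < 1 - s) cgt0.
by clearbody s; lra.
Qed.

(** [cfix] is a choice by [get]; [CND_fix] shows that the set chosen from is inhabited. *)
Lemma cfixP : 0 <= cfix f < 1 / 2 /\ f (1 - cfix f) = cfix f.
Proof.
have [c01 fc] : [set c : R | 0 <= c <= 1 /\ f (1 - c) = c] (cfix f).
  apply: getPex; exists (F (- (1 / 2))).
  by split; [exact: rcdf_itv|exact: CND_fix].
split=> //; have /andP[-> _] := c01.
exact: tradeoff_function_fix_lt_half fc.
Qed.

Let c := cfix f.
Let r := c / (1 - c).

Lemma CND_ratio_ge0 : 0 <= r.
Proof. by have [/andP[c0 c1] _] := cfixP; rewrite divr_ge0// /c; lra. Qed.

Lemma CND_cdf_geometric (x : R) : x <= 0 -> F (x - 1) <= r * F x.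
Proof.
move=> x0; have [/andP[c0 c1] fc] := cfixP; rewrite -/c in c0 c1 fc.
have r0 := CND_ratio_ge0.
have F0 : F 0 = 1 / 2 by have := CND_cdf_sym 0; rewrite oppr0; lra.
have Fx : F x <= 1 / 2 by rewrite -F0 rcdf_nondecreasing.
have /andP[Fx0 _] := rcdf_itv N x.
apply/ler_addgt0Pr => e e0.
(* A level [a] strictly above [F x] is needed, at most [1 - c] for the chord of slope [r] to apply.
   As [F x <= 1 / 2], the midpoint [m] of [1 / 2] and [1 - c] leaves room on both sides. *)
pose m := (1 / 2 + (1 - c)) / 2; pose a := Num.min m (F x + e).
have am : a <= m by rewrite ge_min lexx.
have ac : a <= 1 - c by rewrite (le_trans am)// /m; lra.
have a1 : a < 1 by rewrite (le_lt_trans am)// /m; lra.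
have ae : a <= F x + e by rewrite ge_min lexx orbT.
have Fxa : F x < a by rewrite lt_min ltrDl e0 andbT /m; lra.
apply: le_trans (@CND_cdf_shift_le x a _) _; first by rewrite Fxa.
pose s := a / (1 - c); have sa : s * (1 - c) = a by rewrite divfK//; lra.
have s01 : 0 <= s <= 1 by rewrite divr_ge0/= ?ler_pdivrMr; lra.
have := tradeoff_function_le_scale f_tradeoff (a := 1 - c) s01 ltac:(lra).
have -> : s * f (1 - c) = r * a by rewrite fc /s /r mulrC mulrA mulrAC.
have r1 : r <= 1 by rewrite ler_pdivrMr; lra.
by rewrite sa => /le_trans; apply; nra.
Qed.

Lemma CND_cdf_geometric_iter (k : nat) (x : R) : x <= 0 ->
  F (x - k%:R) <= r ^+ k * F x.
Proof.
move=> x0; elim: k => [|k IHk]; first by rewrite subr0 expr0 mul1r.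
rewrite -natr1 opprD addrA exprS -mulrA.
apply: le_trans (CND_cdf_geometric _) _; last first.
  by rewrite ler_wpM2l// CND_ratio_ge0.
by rewrite subr_le0 (le_trans x0).
Qed.

(** By symmetry each of the two tails is at most [F (- t)]. Iterating from [k - t <= 0], where [F]
    is at most [1 / 2], bounds each by half of [r ^+ k]. *)
Lemma CND_tail (k : nat) (t : R) : k%:R <= t ->
  (P [set w | (t < `|N w|)%R] <= (r ^+ k)%:E)%E.
Proof.
move=> kt; have r0 : 0 <= r ^+ k by rewrite exprn_ge0// CND_ratio_ge0.
have F0 : F 0 = 1 / 2 by have := CND_cdf_sym 0; rewrite oppr0; lra.
have Ft : F (- t) <= r ^+ k * (1 / 2).
  have -> : - t = (k%:R - t) - k%:R by ring.
  apply: le_trans (CND_cdf_geometric_iter k _) _; first lra.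
  by rewrite ler_wpM2l// -F0 rcdf_nondecreasing//; lra.
have mU : [set w | t < `|N w|] `<=`
    N @^-1` `]-oo, (- t)] `|` N @^-1` `]t, +oo[.
  move=> w /=; rewrite !in_itv/= andbT lter_normr => /orP[|h]; [by right|left].
  by lra.
have m1 : measurable (N @^-1` `]-oo, (- t)]) by exact: measurable_funPTI.
have m2 : measurable (N @^-1` `]t, +oo[) by exact: measurable_funPTI.
have m0 : measurable [set w | t < `|N w|].
  rewrite (_ : [set _ | _] = N @^-1` (~` `[- t, t])).
    by apply: measurable_funPTI => //; exact: measurableC.
  apply/seteqP; split=> w /=; rewrite in_itv/=.
    by move=> tN /andP[h1 h2]; move: tN; rewrite ltNge ler_norml h1 h2.
  by move=> /negP; rewrite -ler_norml -ltNge.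
apply: (@le_trans _ _ (P (N @^-1` `]-oo, (- t)] `|` N @^-1` `]t, +oo[))).
  by apply: le_measure; rewrite ?inE//; exact: measurableU.
apply: (le_trans (measureU2 _ m1 m2)).
apply: (@le_trans _ _ ((F (- t))%:E + (1 - F t)%:E)%E).
  apply: leeD; first by rewrite -rcdfE; exact: lexx.
  by rewrite -distribution_gt; exact: lexx.
by rewrite -EFinD lee_fin; have := CND_cdf_sym t; lra.
Qed.

End canonical_noise.

(** * Partial sums of the exponential series *)

Section exponential_sums.
Context {R : realType}.
Implicit Types (u v e : R).

Local Notation E n u := (series (exp_coeff u) n).

Lemma exp_coeffD u v (n : nat) :
  exp_coeff (u + v) n = \sum_(i < n.+1) exp_coeff u i * exp_coeff v (n - i)%N.
Proof.
rewrite /exp_coeff/= addrC exprDn mulr_suml; apply: eq_bigr => i _.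
have ile : (i <= n)%N by rewrite -ltnS.
have := bin_fact ile => /(congr1 (fun k => k%:R : R)); rewrite !natrM => h.
have f0 (k : nat) : k`!%:R != 0 :> R by rewrite pnatr_eq0 -lt0n fact_gt0.
rewrite -mulr_natr -h; field.
by rewrite !f0/= pnatr_eq0 -lt0n bin_gt0.
Qed.

(** The Cauchy product, truncated to total degree below [n]. *)
Lemma series_exp_coeffD u v (n : nat) :
  E n (u + v) = \sum_(i < n) exp_coeff u i * E (n - i)%N v.
Proof.
elim: n => [|n IHn]; first by rewrite /series/= big_geq// big_ord0.
rewrite seriesSr IHn exp_coeffD [in LHS]big_ord_recr [in RHS]big_ord_recr/=.
rewrite subnn subSnn seriesSr addrA; congr (_ + _).
  rewrite -big_split/=; apply: eq_bigr => i _.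
  by rewrite subSn ?seriesSr ?mulrDr// ltnW.
by rewrite /series/= big_geq// add0r.
Qed.

Lemma series_exp_coeff_le_expR u (n : nat) : 0 <= u -> E n u <= expR u.
Proof.
move=> u0; apply: nondecreasing_cvgn_le; last exact: is_cvg_series_exp_coeff.
by apply: nondecreasing_series => k _ _; exact: exp_coeff_ge0.
Qed.

(** In the Cauchy product the term [i = n] carries a single-term series in [v], equal to 1; the
    series in [v] of all other terms are at most [expR v]. *)
Lemma series_exp_coeff_shift u v (n : nat) : 0 <= u -> 0 <= v ->
  E n.+1 (u + v) <= exp_coeff u n + expR v * E n u.
Proof.
move=> u0 v0; rewrite series_exp_coeffD big_ord_recr/= subSnn addrC lerD//.
  by rewrite seriesSr /series/= big_geq// add0r /exp_coeff/= expr0 divr1 mulr1.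
rewrite /series/= big_mkord mulr_sumr ler_sum// => i _.
by rewrite mulrC ler_wpM2r ?exp_coeff_ge0// series_exp_coeff_le_expR.
Qed.

(** [expR (- a)] is at most [1 / (1 + a)], and [(1 + a) * (1 - a + a ^+ 2) = 1 + a ^+ 3]. *)
Lemma expRN_le (a : R) : 0 <= a -> expR (- a) <= 1 - a + a ^+ 2.
Proof.
move=> a0; have := expR_ge1Dx a; have := expRxMexpNx_1 a.
have := expR_gt0 (- a); set E := expR a; set E' := expR (- a) => E'0 EE' aE.
have h1 : (1 + a) * E' <= 1 by rewrite -[leRHS]EE' ler_pM2r.
have h2 : 1 <= (1 + a) * (1 - a + a ^+ 2).
  have := exprn_ge0 3 a0; lra.
have a1 : 0 < 1 + a by lra.
by rewrite -(ler_pM2l a1) (le_trans h1).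
Qed.

(** A discrete Gamma integral: the remainder [C * expR (- e) ^+ K * E n (e * K%:R)] added in the
    proof equals [expR e] times the integral of [n * t ^ (n - 1) * exp (- e * t)] over [t >= K]. The
    factor [expR e] pays for replacing [t] by its floor in the exponential. *)
Lemma sum_powers_geometric e (n K : nat) : 0 < e -> (0 < n)%N ->
  \sum_(k < K) (k.+1%:R ^+ n - k%:R ^+ n) * expR (- e) ^+ k <=
    e ^- n * expR e * n`!%:R.
Proof.
move=> e0 n0; set C := _ * _ * _; have C0 : 0 <= C.
  by rewrite !mulr_ge0 ?expR_ge0// invr_ge0 exprn_ge0// ltW.
(* By series_exp_coeff_shift, the second summand dominates the tail of the
   series. *)
suff : \sum_(k < K) (k.+1%:R ^+ n - k%:R ^+ n) * expR (- e) ^+ k +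
    C * expR (- e) ^+ K * E n (e * K%:R) <= C.
  apply: le_trans; rewrite lerDl; apply: mulr_ge0.
    by apply: mulr_ge0 => //; rewrite exprn_ge0// expR_ge0.
  by apply: sumr_ge0 => i _; rewrite exp_coeff_ge0// mulr_ge0// ltW.
elim: K => [|K IHK].
  rewrite big_ord0 add0r expr0 mulr1 mulr0.
  by case: n n0 @C C0 => // n _ C C0; rewrite series_exp_coeff0 mulr1.
apply: le_trans IHK; rewrite big_ord_recr/= -addrA lerD2l.
have := @series_exp_coeff_shift (e * K%:R) e n.
rewrite (_ : e * K%:R + e = e * K.+1%:R); last by rewrite -natr1 mulrDr mulr1.
rewrite mulr_ge0 ?(ltW e0)// => /(_ isT isT).
rewrite seriesSr; set S1 := series _ n; set S0 := series _ n => h.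
have x0 : 0 <= expR (- e) ^+ K by rewrite exprn_ge0// expR_ge0.
have D0 : 0 <= e ^- n * n`!%:R by rewrite mulr_ge0// invr_ge0 exprn_ge0// ltW.
have := ler_wpM2l (mulr_ge0 D0 x0) h.
have fn0 : n`!%:R != 0 :> R by rewrite pnatr_eq0 -lt0n fact_gt0.
have en0 : e ^+ n != 0 by rewrite expf_neq0// gt_eqF.
(* Scaled in this way, the degree [n] coefficients in the shift inequality become the powers in the
   sum. *)
have coeffE (k : nat) : e ^- n * n`!%:R * exp_coeff (e * k%:R) n = k%:R ^+ n.
  by rewrite /exp_coeff/= exprMn; field; rewrite fn0.
rewrite -(coeffE K) -(coeffE K.+1) exprS /C.
set x := _ ^+ K.
rewrite (_ : e ^- n * expR e * n`!%:R * (expR (- e) * x) * S1 =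
             e ^- n * n`!%:R * x * S1); last first.
  by rewrite -[RHS]mulr1 -(expRxMexpNx_1 e); ring.
lra.
Qed.
End exponential_sums.

(** * Absolute moments from geometric tails *)

Section expectation_bounds.
Context {d : measure_display} {Omega : measurableType d} {R : realType}.
Context {P : probability Omega R}.

(** Monotone convergence. The slack [e] lets the pointwise bound hold only in the limit, as needed
    for the exponential series. *)
Lemma expectation_le_series (X : Omega -> R) (Y : nat -> Omega -> R) (B : R) :
  measurable_fun setT X -> (forall k, measurable_fun setT (Y k)) ->
  (forall w, 0 <= X w) -> (forall k w, 0 <= Y k w) ->
  (forall w e, 0 < e -> exists K, X w <= \sum_(k < K) Y k w + e) ->
  (forall K, (\sum_(k < K) 'E_P[Y k] <= B%:E)%E) ->
  ('E_P[X] <= B%:E)%E.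
Proof.
move=> mX mY X0 Y0 XY YB.
apply: (@le_trans _ _ (\int[P]_w (\sum_(k <oo) (Y k w)%:E))%E).
  rewrite unlock; apply: ge0_le_integral => //.
  - by move=> w _; rewrite lee_fin.
  - exact/measurable_EFinP.
  - by apply: ge0_emeasurable_sum => [k w _ _|k _];
      [rewrite lee_fin|exact/measurable_EFinP].
  - move=> w _; apply/lee_addgt0Pr => e e0; have [K XK] := XY w e e0.
    rewrite -lee_fin EFinD in XK; apply: (le_trans XK); rewrite leeD2r//.
    rewrite -sumEFin -(big_mkord xpredT (fun k => (Y k w)%:E)).
    by apply: nneseries_lim_ge => k _; rewrite lee_fin.
rewrite integral_nneseries//; last 2 first.
- by move=> k; exact/measurable_EFinP.
- by move=> k w _; rewrite lee_fin.
apply: lime_le.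
  apply: is_cvg_nneseries => k _ _.
  by rewrite integral_ge0// => w _; rewrite lee_fin.
apply: nearW => K; have := YB K; rewrite big_mkord.
by rewrite expectation.unlock.
Qed.

Lemma abs_moment_le (N : {RV P >-> R}) (e : R) (n : nat) : 0 < e -> (0 < n)%N ->
  (forall k : nat, (P [set w | (k%:R < `|N w|)%R] <= (expR (- e) ^+ k)%:E)%E) ->
  ('E_P[(fun w => `|N w| ^+ n)%R] <= (e ^- n * expR e * n`!%:R)%:E)%E.
Proof.
move=> e0 n0 tail.
have mN : measurable_fun setT (fun w => `|N w|) by exact: measurableT_comp.
have mgt (k : nat) : measurable [set w | k%:R < `|N w|].
  rewrite (_ : [set _ | _] = (fun w => `|N w|) @^-1` `]k%:R, +oo[).
    by rewrite -[X in measurable X]setTI; exact: mN.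
  by apply/seteqP; split=> w /=; rewrite in_itv/= andbT.
have coef0 (k : nat) : 0 <= k.+1%:R ^+ n - k%:R ^+ n :> R.
  by rewrite subr_ge0 lerXn2r ?nnegrE// ler_nat.
pose Y (k : nat) (w : Omega) : R :=
  (k.+1%:R ^+ n - k%:R ^+ n) * \1_[set w | k%:R < `|N w|] w.
apply: (@expectation_le_series _ Y).
- exact: measurable_funX.
- by move=> k; apply: measurable_funM => //; exact: measurable_indic.
- by move=> w; rewrite exprn_ge0.
- by move=> k w; rewrite mulr_ge0// indicE ler0n.
- move=> w u u0; exists (Num.truncn `|N w|).+1.
  apply: ler_wpDr; first exact: ltW.
  set m := Num.truncn _.
  have mleN : m%:R <= `|N w| by rewrite truncn_le.
  rewrite big_ord_recr/=.
  rewrite (eq_bigr (fun k : 'I_m => k.+1%:R ^+ n - k%:R ^+ n)); last first.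
    move=> k _; rewrite /Y indicE mem_set ?mulr1//=.
    by rewrite (lt_le_trans _ mleN)// ltr_nat.
  rewrite -(big_mkord xpredT (fun k => k.+1%:R ^+ n - k%:R ^+ n : R)).
  rewrite telescope_sumr// expr0n gtn_eqF// subr0 /Y indicE.
  (* The terms [k < m] telescope to [m ^ n]. The term [k = m] raises this to [(m + 1) ^ n], except
     when [|N w|] is exactly [m], and then [m ^ n] is already enough. *)
  have [mltN|Nm] := ltP (m%:R : R) `|N w|.
    rewrite mem_set// mulr1 addrCA subrr addr0.
    by rewrite lerXn2r ?nnegrE// ltW// truncnS_gt.
  by rewrite memNset ?mulr0 ?addr0 ?lerXn2r ?nnegrE//= => /lt_geF; rewrite Nm.
- move=> K.
  apply: (@le_trans _ _ (\sum_(k < K)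
      (k.+1%:R ^+ n - k%:R ^+ n) * expR (- e) ^+ k)%:E); last first.
    by rewrite lee_fin; exact: sum_powers_geometric.
  rewrite -sumEFin; apply: lee_sum => k _.
  rewrite expectation.unlock /Y; under eq_integral do rewrite EFinM.
  rewrite ge0_integralZl//; last 2 first.
  + by apply/measurable_EFinP; exact: measurable_indic.
  + by rewrite lee_fin.
  rewrite integral_indic// setIT EFinM lee_wpmul2l//.
    exact: coef0.
  exact: tail.
Qed.
End expectation_bounds.

(** Open right rays are stable under intersection, generate the Borel sets, and those starting at
    [- k] cover the line. *)
Lemma eq_measure_rays {R : realType}
    (mu nu : probability R R) :
  (forall x : R, mu `]x, +oo[%classic = nu `]x, +oo[%classic) ->
  forall A, measurable A -> mu A = nu A.
Proof.
move=> mu_nu A mA.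
refine (@measure_unique _ R _ (@RGenOInfty.G R)
  (fun k : nat => `](- k%:R), +oo[%classic) _ _ _ _ mu nu _ _ A mA) => //.
- exact: RGenOInfty.measurableE.
- move=> _ _ [x ->] [y ->]; exists (Num.max x y).
  by apply/seteqP; split=> z /=; rewrite !in_itv/= !andbT gt_max => /andP.
- by move=> k; exists (- k%:R).
- apply/seteqP; split=> // x _; exists (Num.bound `|x|) => //=.
  rewrite in_itv/= andbT ltrNl (le_lt_trans (ler_norm _))// normrN//.
  exact: archi_boundP.
- by move=> _ [x ->]; exact: mu_nu.
- by move=> k; rewrite (le_lt_trans (probability_le1 _ _))// ltry.
Qed.

(** * Symmetry of the law from symmetry of the cdf *)

Section symmetric_law.
Context {d : measure_display} {Omega : measurableType d} {R : realType}.
Context {P : probability Omega R} (N : {RV P >-> R}).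
Hypothesis Fsym : forall x, rcdf N x = 1 - rcdf N (- x).
Hypothesis Fcont : continuous (rcdf N).

Lemma ge0_expectation_sym (g : R -> R) : measurable_fun setT g ->
  (forall x, 0 <= g x) ->
  'E_P[(fun w => g (N w))]%E = 'E_P[(fun w => g (- N w)%R)]%E.
Proof.
pose N' : {RV P >-> R} := (\- N)%R.
have ray_eq (x : R) :
    distribution P N `]x, +oo[%classic = distribution P N' `]x, +oo[%classic.
  apply: (@etrans _ _ (1 - rcdf N x)%:E).
    exact: distribution_gt.
  have := Fsym (- x); rewrite opprK => Fx.
  pose B := N @^-1` `]-oo, - x[.
  have mB : measurable B by exact: measurable_funPTI.
  have PB : P B \is a fin_num by exact: fin_num_measure.
  have -> : distribution P N' `]x, +oo[%classic = P B.
    rewrite /distribution/= /pushforward; congr (P _).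
    by apply/seteqP; split=> w /=; rewrite !in_itv/= andbT ltrNr.
  rewrite -Fx -[P B]fineK//; congr EFin.
  (* The ray of [- N] gives the event [N < - x], the cdf the event [N <= - x]; left continuity of
     the cdf at [- x] identifies their probabilities. *)
  apply/le_anti/andP; split.
    apply: (cvgr_to_le (cvg_at_left_filter (@Fcont (- x)))).
    near=> z; rewrite -lee_fin -rcdfE fineK//.
    apply: le_measure; rewrite ?inE//.
    move=> w /=; rewrite !in_itv/= => /le_lt_trans; apply.
    by near: z; exact: nbhs_left_lt.
  rewrite -lee_fin -rcdfE fineK//.
  apply: le_measure; rewrite ?inE//; first exact: measurable_funPTI.
  by move=> w /=; rewrite !in_itv/= => /ltW.
move=> mg g0; rewrite expectation.unlock.
rewrite -(@ge0_integral_distribution _ _ _ _ _ P N (EFin \o g))//; last first.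
  exact/measurable_EFinP.
rewrite -(@ge0_integral_distribution _ _ _ _ _ P N' (EFin \o g))//; last first.
  exact/measurable_EFinP.
apply: eq_measure_integral => A mA _.
by apply: (@eq_measure_rays R (distribution P N) (distribution P N')).
Unshelve. all: by end_near.
Qed.

End symmetric_law.

(** * From moment bounds to the sub-exponential property *)

Section sub_exponential_of_moments.
Context {d : measure_display} {Omega : measurableType d} {R : realType}.
Context {P : probability Omega R} (N : {RV P >-> R}).
Hypothesis Fsym : forall x, rcdf N x = 1 - rcdf N (- x).
Hypothesis Fcont : continuous (rcdf N).
Variable e : R.
Hypothesis e0 : 0 < e.
Hypothesis moments : forall n : nat, (0 < n)%N ->
  ('E_P[(fun w => `|N w| ^+ n)%R] <= (e ^- n * expR e * n`!%:R)%:E)%E.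

Lemma moments_integrable : P.-integrable setT (EFin \o N).
Proof.
apply/integrableP; split; first exact/measurable_EFinP.
apply: le_lt_trans (ltry (e ^- 1 * expR e * 1`!%:R)).
by apply: le_trans (moments (ltn0Sn 0)); rewrite expectation.unlock.
Qed.

(** By symmetry the positive and negative parts have the same integral, which is finite by the first
    moment bound. *)
Lemma moments_expectation0 : 'E_P[N]%E = 0%E.
Proof.
have iN := moments_integrable.
have posN : (\int[P]_w (EFin \o N)^\+ w = \int[P]_w (EFin \o N)^\- w)%E.
  have := @ge0_expectation_sym _ _ _ P N Fsym Fcont (fun x => Num.max x 0).
  rewrite expectation.unlock => h; under eq_integral do rewrite funeposE.
  under [RHS]eq_integral do rewrite funenegE.
  apply: etrans (etrans (h _ _) _).
  - by apply: eq_integral => w _ /=; rewrite EFin_max.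
  - exact: measurable_maxr.
  - by move=> x; rewrite le_max lexx orbT.
  - by apply: eq_integral => w _ /=; rewrite EFin_max.
rewrite expectation.unlock integralE posN subee//.
exact: integrable_neg_fin_num.
Qed.

Lemma moments_cosh (l : R) : `|l| < e / 2 ->
  ('E_P[(fun w => expR (l * N w) + expR (- (l * N w)))%R] <=
     (2 + 4 * expR e * (`|l| / e) ^+ 2)%:E)%E.
Proof.
move=> le2; pose x := `|l| / e.
have x0 : 0 <= x by rewrite divr_ge0// ltW.
have x2 : x <= 1 / 2 by rewrite /x ler_pdivrMr//; lra.
have E0 := expR_ge0 e.
pose a w := `|l| * `|N w|.
have a0 w : 0 <= a w by rewrite mulr_ge0.
have mN : measurable_fun setT (fun w => `|N w|) by exact: measurableT_comp.
have ma : measurable_fun setT a by exact: measurable_funM.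
(* exp a + exp (- a) <= \sum_k a^k/k! + (1 - a + a^2): the second part turns the
   terms 1 and a into 2 and a^2. *)
pose Y (k : nat) (w : Omega) : R :=
  match k with 0 => 2 | 1 => a w ^+ 2 | _ => exp_coeff (a w) k end.
(* [b k] bounds the expectation of [Y k]: the factorial in the moment bound cancels the one in
   [exp_coeff], while for [k = 1] the uncancelled [2!] gives the factor 2. *)
pose b (k : nat) : R :=
  match k with 0 => 2 | 1 => 2 * (expR e * x ^+ 2) | _ => expR e * x ^+ k end.
have b0 k : 0 <= b k.
  have xE0 n : 0 <= expR e * x ^+ n by rewrite mulr_ge0// exprn_ge0.
  by case: k => [|[|k]] //=; rewrite mulr_ge0.
have EXn (c : R) (n : nat) : 0 <= c -> (0 < n)%N ->
    ('E_P[(fun w => c * a w ^+ n)%R] <= (c * n`!%:R * (expR e * x ^+ n))%:E)%E.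
  move=> c0 n0.
  have -> : c * n`!%:R * (expR e * x ^+ n) =
      (c * `|l| ^+ n) * (e ^- n * expR e * n`!%:R) by rewrite expr_div_n; ring.
  rewrite EFinM.
  apply: le_trans (lee_wpmul2l _ (moments n0)); last first.
    by rewrite lee_fin mulr_ge0// exprn_ge0.
  rewrite expectation.unlock -ge0_integralZl//.
  - rewrite le_eqVlt; apply/orP; left; apply/eqP.
    by apply: eq_integral => w _; rewrite -EFinM /a exprMn mulrA.
  - exact/measurable_EFinP/measurable_funX.
  - by rewrite lee_fin mulr_ge0// exprn_ge0.
apply: (@expectation_le_series _ _ _ P _ Y).
- apply: measurable_funD; apply: measurableT_comp => //.
    exact: measurable_funM.
  by apply: measurableT_comp => //; exact: measurable_funM.
- move=> [|[|k]]; rewrite /Y; [exact: measurable_cst|exact: measurable_funX|].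
  by rewrite /exp_coeff/=; apply: measurable_funM => //; exact: measurable_funX.
- by move=> w; rewrite addr_ge0// expR_ge0.
- by move=> [|[|k]] w; rewrite /Y ?exp_coeff_ge0// exprn_ge0.
- move=> w u u0.
  have cosh_abs :
      expR (l * N w) + expR (- (l * N w)) = expR (a w) + expR (- a w).
    rewrite /a -normrM; case: (ger0P (l * N w)) => // _.
    by rewrite opprK addrC.
  have : series (exp_coeff (a w)) n @[n --> \oo] --> expR (a w).
    exact: is_cvg_series_exp_coeff.
  move=> /(cvgr_gt _)/(_ (expR (a w) - u)) /(_ ltac:(lra))[K _ hK].
  exists K.+2; have := hK K.+2 (leq_trans (leqnSn _) (leqnSn _)).
  rewrite /series/= big_mkord !big_ord_recl/= cosh_abs.
  have := expRN_le (a0 w).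
  rewrite /exp_coeff/= expr0 expr1 !divr1.
  lra.
- move=> K; apply: (@le_trans _ _ (\sum_(k < K) b k)%:E).
    rewrite -sumEFin; apply: lee_sum => -[[|[|k]] kK] _ /=.
    + by rewrite (expectation_cst P 2).
    + have := @EXn 1 2 ler01 isT; rewrite mul1r.
      by under eq_fun do rewrite mul1r.
    + have := @EXn (k.+2`!%:R^-1) k.+2.
      rewrite mulVf ?pnatr_eq0 -?lt0n ?fact_gt0//.
      rewrite mul1r invr_ge0 ler0n => /(_ isT isT).
      by under eq_fun do rewrite mulrC.
  (* Two more nonnegative terms let the exceptional [b 0] and [b 1] be split off for every [K]. The
     rest is a geometric sum, at most 2 times its first term since [x <= 1 / 2], for a total of
     [2 + (2 + 2) * expR e * x ^+ 2]. *)
  rewrite lee_fin; apply: (@le_trans _ _ (\sum_(k < K.+2) b k)).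
    rewrite !big_ord_recr/= -addrA lerDl.
    exact: (addr_ge0 (b0 K) (b0 K.+1)).
  rewrite !big_ord_recl/=.
  have -> : \sum_(i < K) b (bump 0 (bump 0 i)) =
            expR e * x ^+ 2 * \sum_(i < K) x ^+ i.
    by rewrite mulr_sumr; apply: eq_bigr => i _; rewrite /b/= -mulrA -exprD.
  have geo : \sum_(i < K) x ^+ i <= 2.
    have := subrX1 x K; set G := \sum_(i < K) _ => h.
    have G0 : 0 <= G by apply: sumr_ge0 => i _; rewrite exprn_ge0.
    have := exprn_ge0 K x0; nra.
  have := ler_wpM2l (mulr_ge0 E0 (exprn_ge0 2 x0)) geo.
  by rewrite -/x; lra.
Qed.

Lemma moments_sub_exponential : sub_exponential N (4 * expR e / e ^+ 2) (2 / e).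
Proof.
rewrite /sub_exponential moments_expectation0/=; split.
  exact: moments_integrable.
move=> l; rewrite div1r invf_div => le2.
rewrite (_ : (fun w => _) = (fun w => expR (l * N w))); last first.
  by apply/funext => w; rewrite subr0.
set z := 'E_P[_]%E; have := moments_cosh le2.
have mexp (s : R) : measurable_fun setT (fun y : R => expR (s * y)).
  by apply: measurableT_comp => //; exact: measurable_funM.
have z_sym : z = 'E_P[(fun w => expR (- (l * N w)))%R]%E.
  have -> : (fun w => expR (- (l * N w))) = (fun w => expR (l * - N w)).
    by apply/funext => w; rewrite mulrN.
  exact: (ge0_expectation_sym Fsym Fcont (mexp l) (fun y => expR_ge0 _)).
have -> : 'E_P[(fun w => expR (l * N w) + expR (- (l * N w)))%R]%E = (z + z)%E.
  rewrite [X in _ = (_ + X)%E]z_sym /z expectation.unlock -ge0_integralD//.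
  - by apply/measurable_EFinP; exact: (measurableT_comp (mexp l)).
  - apply/measurable_EFinP; under eq_fun do rewrite -mulNr.
    exact: (measurableT_comp (mexp (- l))).
have lE : l ^+ 2 * (4 * expR e / e ^+ 2) / 2 = 2 * expR e * (`|l| / e) ^+ 2.
  by rewrite expr_div_n real_normK ?num_real//; field; rewrite gt_eqF.
(* Half of the bound of [moments_cosh] has the form [1 + y], hence is at most [expR y]. *)
have h := expR_ge1Dx (2 * expR e * (`|l| / e) ^+ 2).
rewrite lE; case: (z) => [y| |]; rewrite ?leNye//.
by rewrite -EFinD !lee_fin; lra.
Qed.

End sub_exponential_of_moments.

(** * The extended-real exponent [epsf f] *)

Section epsilon.
Context {R : realType} (f : R -> R).
Hypothesis c_itv : 0 <= cfix f < 1 / 2.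

Lemma epsf_gt0 : (0 < epsf f)%E.
Proof.
have /andP[c0 c1] := c_itv; rewrite /epsf lne_gt0.
have [->|cneq0] := eqVneq (cfix f) 0; first by rewrite subr0 inve0 mul1e ltry.
have c_gt0 : 0 < cfix f by rewrite lt_neqAle eq_sym cneq0.
by rewrite inver (negbTE cneq0) -EFinM lte_fin ltr_pdivlMr// mul1r; lra.
Qed.

Lemma expeR_epsf (k : nat) :
  expeR (- (epsf f * k%:R%:E)) = ((cfix f / (1 - cfix f)) ^+ k)%:E.
Proof.
have /andP[c0 c1] := c_itv; rewrite /epsf.
(* Here [epsf f] is [+oo]: for [k = 0] the convention [+oo * 0 = 0] gives 1, which is [0 ^+ 0], and
   for [k > 0] both sides are 0. *)
have [->|cneq0] := eqVneq (cfix f) 0.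
  rewrite subr0 inve0 mul1e /= mul0r expr0n; case: k => [|k].
    by rewrite mule0 oppe0 expeR0.
  by rewrite gt0_mulye ?lte_fin ?ltr0Sn.
have c_gt0 : 0 < cfix f by rewrite lt_neqAle eq_sym cneq0.
have q_gt0 : 0 < (1 - cfix f) / cfix f by rewrite divr_gt0//; lra.
rewrite inver (negbTE cneq0) -EFinM lne_EFin//= -mulNr expRM_natr expRN lnK//.
by rewrite invf_div.
Qed.

End epsilon.

(* Item 1 is stated with an extended-real epsf f. In items 2 and 3 epsf f has to be
   a real number e, since their bounds are indeterminate for epsf f = +oo. *)
Theorem theorem14 (R : realType) (f : R -> R)
    (d : measure_display) (Omega : measurableType d)
    (P : probability Omega R) (N : {RV P >-> R})
    (f_sym : symmetric_tradeoff f) (f_nontriv : nontrivial f)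
    (N_cnd : is_CND f N) :
  [/\ (forall t : R, 0 <= t ->
         (P [set w | (t < `|N w|)%R] <=
            expeR (- (epsf f * ((Num.floor t)%:~R)%:E)))%E /\
         (expeR (- (epsf f * ((Num.floor t)%:~R)%:E)) <=
            expeR (- (epsf f * (t - 1)%:E)))%E),
      (forall e : R, epsf f = e%:E ->
         forall n : nat, (0 < n)%N ->
         ('E_P[(fun w => (`|N w| ^+ n)%R)] <=
            (e ^- n * expR e * n`!%:R)%:E)%E) &
      (forall e : R, epsf f = e%:E ->
         sub_exponential N (4 * expR e / e ^+ 2) (2 / e))].
Proof.
have [c_itv _] := cfixP f_nontriv N_cnd.
have eps0 := epsf_gt0 c_itv.
have tail (e : R) : epsf f = e%:E -> forall k : nat,
    (P [set w | (k%:R < `|N w|)%R] <= (expR (- e) ^+ k)%:E)%E.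
  move=> fe k; have := expeR_epsf c_itv k.
  by rewrite fe /= -mulNr expRM_natr => ->; exact: CND_tail.
have moments (e : R) : epsf f = e%:E -> forall n : nat, (0 < n)%N ->
    ('E_P[(fun w => (`|N w| ^+ n)%R)] <= (e ^- n * expR e * n`!%:R)%:E)%E.
  move=> fe n n0; apply: abs_moment_le => //; last exact: tail.
  by rewrite -lte_fin -fe.
split; [|exact: moments|].
- move=> t t0; split; last first.
    rewrite lee_expeR leeN2 lee_wpmul2l ?(ltW eps0)// lee_fin.
    by have := floorD1_gt t; rewrite lerBlDr intrD => /ltW.
  have floor_t : Num.floor t = `|Num.floor t|%N.
    by rewrite gez0_abs// floor_ge0.
  rewrite floor_t -pmulrn expeR_epsf//; apply: CND_tail => //.
  by rewrite pmulrn -floor_t floor_le.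
- move=> e fe; apply: moments_sub_exponential (moments e fe).
  + exact: (CND_cdf_sym N_cnd).
  + by case: N_cnd.
  + by rewrite -lte_fin -fe.
Qed.
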